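(* Let $f=(f_1,f_2,\dots,f_m)$ where each $f_j\in C_0^\infty(\mathbb R^n)$ is real-valued. Let $n\geq 2$, $r>p>2$, and let $\alpha,\beta,\gamma$ be fixed real numbers such that $$\frac{1}{p}+\frac{\alpha}{n}>0,\qquad \frac{p-1}{p(r-1)}+\frac{\beta}{n}>0,\qquad \frac{1}{r}+\frac{\gamma}{n}>0,$$ and $$\gamma=\frac{1}{r}(\alpha-1)+\frac{p-1}{pr}\beta .$$ Then $$\left(\int_{\mathbb R^n}|x|^{\alpha p} |\nabla f(x)|^p\, dx\right)\left(\int_{\mathbb R^n}|x|^\beta |f(x)|^{\frac{p(r-1)}{p-1}}\,dx\right)^{p-1} \geq \left(\frac{n+\gamma r}{r}\right)^p\left(\int_{\mathbb R^n} |x|^{\gamma r}|f(x)|^r\, dx\right)^p + \left(\int_{\mathbb R^n}|x|^{r\gamma +1}\, |\Phi_f'(x)|\, |f(x)|^{r}\,dx\right)^p .$$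
   Context: $C_0^\infty(\mathbb R^n)$ denotes the smooth functions with compact support in $\mathbb R^n$. For vector-valued $f=(f_1,\dots,f_m)$: $|f(x)|^2=\sum_{j=1}^m f_j(x)^2$ and $|\nabla f(x)|^2=\sum_{k=1}^n\sum_{j=1}^m|\partial_k f_j(x)|^2$. Generalized phase derivative: at points where $f(x)\ne 0$, $$|\Phi_f'(x)|=\left(\sum_{k=1}^n\sum_{1\leq j<l\leq m}\left(\frac{f_l(x)}{|f(x)|^2}\partial_k f_j(x)-\frac{f_j(x)}{|f(x)|^2}\partial_k f_l(x)\right)^2\right)^{1/2}.$$ Integrands containing the product of a positive power of $|f(x)|$ with $|\Phi_f'(x)|$ are taken to be $0$ at points where $f(x)=0$. *)

(* Defs.v *)
From HB Require Import structures.
From mathcomp Require Import all_boot all_order all_algebra.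
From mathcomp Require Import all_classical all_reals all_analysis.

Set Implicit Arguments.
Unset Strict Implicit.
Unset Printing Implicit Defensive.

Import Order.TTheory GRing.Theory Num.Theory.
Import numFieldNormedType.Exports.

Local Open Scope classical_set_scope.
Local Open Scope ring_scope.

Definition measure_rV_display : measure_display -> measure_display.
Proof. exact. Qed.

Section measurable_rV.
Context {d} {T : measurableType d} (n : nat).

Let coors : 'I_n -> 'rV[T]_n -> T := fun i x => x ord0 i.

Let rV_set0 : g_sigma_preimage coors set0.
Proof. exact: sigma_algebra0. Qed.

Let rV_setC A : g_sigma_preimage coors A -> g_sigma_preimage coors (~` A).
Proof. exact: sigma_algebraC. Qed.

Let rV_bigcup (F : (set 'rV[T]_n)^nat) :
  (forall i, g_sigma_preimage coors (F i)) ->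
  g_sigma_preimage coors (\bigcup_i (F i)).
Proof. exact: sigma_algebra_bigcup. Qed.

(* The product sigma-algebra, generated by the coordinate projections. *)
HB.instance Definition _ := @isMeasurable.Build (measure_rV_display d)
  'rV[T]_n (g_sigma_preimage coors) rV_set0 rV_setC rV_bigcup.

End measurable_rV.

Lemma measurable_coord d (T : measurableType d) n (i : 'I_n) :
  measurable_fun [set: 'rV[T]_n] (fun x : 'rV[T]_n => x ord0 i).
Proof.
move=> _ Y mY; rewrite setTI; apply: sub_sigma_algebra => /=.
rewrite -bigcup_seq/=; exists i => /=; first by rewrite mem_index_enum.
by exists Y => //; rewrite setTI.
Qed.

Lemma measurable_fun_rVP d1 d2 (T1 : measurableType d1)
    (T2 : measurableType d2) n (f : T1 -> 'rV[T2]_n) :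
  measurable_fun [set: T1] f <->
  forall i, measurable_fun [set: T1] (fun t => f t ord0 i).
Proof.
split=> [mf i|mf].
  exact: (measurableT_comp (@measurable_coord _ T2 n i) mf).
apply: (@measurability _ _ _ _ setT f
  (\big[setU/set0]_(i < n) preimage_set_system setT
     (fun x : 'rV[T2]_n => x ord0 i) measurable)) => //.
move=> _ [A + <-]; rewrite -bigcup_seq/= => -[i _ [B mB <-]].
by rewrite setTI; exact: mf.
Qed.

Section cons_rV.
Context {d} {T : measurableType d} (n : nat).

Definition cons_rV (z : T * 'rV[T]_n) : 'rV[T]_n.+1 :=
  \row_i oapp (z.2 ord0) z.1 (unlift ord0 i).

Lemma measurable_cons_rV : measurable_fun [set: T * 'rV[T]_n] cons_rV.
Proof.
apply/measurable_fun_rVP => i; rewrite /cons_rV.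
case: (unliftP ord0 i) => [j|] ->.
  rewrite (_ : (fun _ => _) = (fun x : 'rV[T]_n => x ord0 j) \o snd).
    by apply: measurableT_comp => //; exact: measurable_coord.
  by apply/funext => z /=; rewrite mxE liftK.
rewrite (_ : (fun _ => _) = fst)//.
by apply/funext => z /=; rewrite mxE unlift_none.
Qed.

Definition uncons_rV (x : 'rV[T]_n.+1) : T * 'rV[T]_n :=
  (x ord0 ord0, \row_i x ord0 (lift ord0 i)).

Lemma measurable_uncons_rV : measurable_fun [set: 'rV[T]_n.+1] uncons_rV.
Proof.
apply/measurable_fun_pairP; split; first exact: measurable_coord.
apply/measurable_fun_rVP => i /=.
rewrite (_ : (fun _ => _) = fun x : 'rV[T]_n.+1 => x ord0 (lift ord0 i)).
  exact: measurable_coord.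
by apply/funext => z /=; rewrite mxE.
Qed.

Lemma cons_rVK : cancel cons_rV uncons_rV.
Proof.
move=> [t x]; rewrite /uncons_rV /cons_rV mxE unlift_none; congr pair.
by apply/rowP => i; rewrite !mxE liftK.
Qed.

Lemma uncons_rVK : cancel uncons_rV cons_rV.
Proof.
move=> x; apply/rowP => i; rewrite /cons_rV mxE.
by case: (unliftP ord0 i) => [j|] -> /=; rewrite ?liftK ?unlift_none ?mxE.
Qed.

End cons_rV.

(* The measurable structure carried by [lebesgue_measure] is that of
   [measurableTypeR R], an alias of [R]; hence the alias under ['rV]. *)
Section lebesgue_rV_step.
Context {R : realType} (n : nat).
Let T := measurableTypeR R.
Variable m : {sigma_finite_measure set 'rV[T]_n -> \bar R}.

Definition lebesgue_rV_step : set 'rV[T]_n.+1 -> \bar R :=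
  pushforward (lebesgue_measure \x m)%E (@cons_rV _ T n).

Let mE A : lebesgue_rV_step A = (lebesgue_measure \x m)%E (@cons_rV _ T n @^-1` A).
Proof. by []. Qed.

Let step0 : lebesgue_rV_step set0 = 0%E.
Proof. by rewrite mE preimage_set0 measure0. Qed.

Let step_ge0 A : (0 <= lebesgue_rV_step A)%E.
Proof. by rewrite mE; exact: measure_ge0. Qed.

Let step_sigma_additive : semi_sigma_additive lebesgue_rV_step.
Proof.
have mcons A : measurable A -> measurable (@cons_rV _ T n @^-1` A).
  by move=> mA; rewrite -[X in measurable X]setTI; exact: measurable_cons_rV.
move=> F mF tF mUF; rewrite /lebesgue_rV_step /pushforward preimage_bigcup.
apply: measure_semi_sigma_additive => [k||]; first exact: mcons.
- apply/trivIsetP => /= i j _ _ ij; rewrite -preimage_setI.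
  by move/trivIsetP : tF => /(_ _ _ _ _ ij) ->//; rewrite preimage_set0.
- by rewrite -preimage_bigcup; exact: mcons.
Qed.

HB.instance Definition _ := isMeasure.Build _ _ _ lebesgue_rV_step
  step0 step_ge0 step_sigma_additive.

(* Proved by hand: canonical inference on [m1 \x m2] selects the instance for
   a pair of subprobabilities, so the sigma-finite one is not found. *)
Let step_sigma_finite : sigma_finite setT lebesgue_rV_step.
Proof.
have /sigma_finiteP[F [TF ndF Foo]] := sigma_finiteT (@lebesgue_measure R).
have /sigma_finiteP[G [TG ndG Goo]] := sigma_finiteT m.
have UFG : \bigcup_k (F k `*` G k) = setT.
  rewrite -setXTT TF TG predeqE => -[x y]; split.
    by move=> [k _ []/= ? ?]; split; exists k.
  move=> [/= [i _ Fix] [k _ Gky]]; exists (maxn i k) => //; split.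
  - by move: x Fix; exact/subsetPset/ndF/leq_maxl.
  - by move: y Gky; exact/subsetPset/ndG/leq_maxr.
exists (fun k => @uncons_rV _ T n @^-1` (F k `*` G k)).
  by rewrite -preimage_bigcup UFG preimage_setT.
move=> k; have [mF Fk] := Foo k; have [mG Gk] := Goo k; split.
  rewrite -[X in measurable X]setTI; apply: measurable_uncons_rV => //.
  exact: measurableX.
rewrite mE (_ : _ @^-1` _ = F k `*` G k); last first.
  by apply/funext => z; rewrite /preimage /mkset cons_rVK.
by rewrite product_measure1E// lte_mul_pinfty// ge0_fin_numE.
Qed.

HB.instance Definition _ := Measure_isSigmaFinite.Build _ _ _
  lebesgue_rV_step step_sigma_finite.

End lebesgue_rV_step.

Fixpoint lebesgue_rV (R : realType) (n : nat) :
    {sigma_finite_measure set 'rV[measurableTypeR R]_n -> \bar R} :=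
  match n with
  | 0 => dirac (point : 'rV[measurableTypeR R]_0)
  | n'.+1 => lebesgue_rV_step (lebesgue_rV R n')
  end.

Lemma lebesgue_rV_box (R : realType) (n : nat)
    (A : 'I_n -> set (measurableTypeR R)) : (forall i, measurable (A i)) ->
  lebesgue_rV R n [set x | forall i, A i (x ord0 i)] =
  (\prod_(i < n) lebesgue_measure (A i))%E.
Proof.
elim: n A => [|n IH] A mA.
  by rewrite big_ord0 /= diracE mem_set//= => -[].
pose B := [set x : 'rV[measurableTypeR R]_n |
             forall i, A (lift ord0 i) (x ord0 i)].
have mB : measurable B.
  rewrite (_ : B = \bigcap_(i in [set: 'I_n])
      ((fun x : 'rV[measurableTypeR R]_n => x ord0 i) @^-1` A (lift ord0 i))).
    apply: fin_bigcap_measurable => // i _; rewrite -[X in measurable X]setTI.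
    exact: measurable_coord.
  by apply/seteqP; split => [x Bx i _|x Bx i]; [exact: Bx|exact: (Bx i)].
rewrite big_ord_recl -(IH (fun i => A (lift ord0 i)))// -product_measure1E//.
congr ((_ \x _)%E _); apply/seteqP; split=> [[t x] /= Ax|[t x] /= [At Ax] i].
  split=> [|i].
    by have := Ax ord0; rewrite /cons_rV mxE unlift_none.
  by have := Ax (lift ord0 i); rewrite /cons_rV mxE liftK.
rewrite /cons_rV mxE; case: (unliftP ord0 i) => [j|] ->/=; [exact: Ax|exact: At].
Qed.

(* Euclidean norm; the library's [`|x|] on row vectors is the sup norm. *)
Definition enorm (R : realType) (n : nat) (x : 'rV[R]_n) : R :=
  Num.sqrt (\sum_i x ord0 i ^+ 2).

Definition partial (R : realType) (n : nat) (k : 'I_n) (g : 'rV[R]_n -> R) :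
    'rV[R]_n -> R :=
  'D_(delta_mx ord0 k) g.

(* All iterated partial derivatives exist and are continuous. *)
Definition smooth (R : realType) (n : nat) (g : 'rV[R]_n -> R) : Prop :=
  forall s : seq 'I_n,
    continuous (foldr (@partial R n) g s) /\
    forall (k : 'I_n) (x : 'rV[R]_n),
      derivable (foldr (@partial R n) g s) x (delta_mx ord0 k).

Definition test_function (R : realType) (n : nat) (g : 'rV[R]_n -> R) : Prop :=
  smooth g /\ compact (closure [set x | g x != 0]).

Section vector_valued.
Variables (R : realType) (n m : nat) (f : 'rV[R]_n -> 'rV[R]_m).

Definition component (j : 'I_m) (x : 'rV[R]_n) : R := f x ord0 j.

Definition grad_norm (x : 'rV[R]_n) : R :=
  Num.sqrt (\sum_(k < n) \sum_(j < m) `|partial k (component j) x| ^+ 2).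

(* Where [f x = 0] this is 0, since division by 0 yields 0; there the products
   with positive powers of [enorm (f x)] vanish, as required. *)
Definition phase_derivative (x : 'rV[R]_n) : R :=
  Num.sqrt (\sum_(k < n) \sum_(j < m) \sum_(l < m | (j < l)%N)
    (component l x / enorm (f x) ^+ 2 * partial k (component j) x -
     component j x / enorm (f x) ^+ 2 * partial k (component l) x) ^+ 2).

End vector_valued.

(* Main.v *)
Require Import Defs.
From mathcomp Require Import all_boot all_order all_algebra.
From mathcomp Require Import all_classical all_reals all_analysis.
From mathcomp Require Import measurable_realfun ring lra.

Set Implicit Arguments.
Unset Strict Implicit.
Unset Printing Implicit Defensive.

Import Order.TTheory GRing.Theory Num.Theory.
Import numFieldNormedType.Exports.

Local Open Scope classical_set_scope.
Local Open Scope ring_scope.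

(** Write [w] for |x|^(gamma r + 1) |f|^(r-1).  The balance condition says
    exactly that [w |grad f|] is the product of |x|^alpha |grad f| and
    |x|^(beta (p-1)/p) |f|^(r-1), so Hoelder's inequality with exponents
    p and p/(p-1) bounds (int w |grad f|)^p by the left-hand side
    ([hoelder_poweR]).

    It remains to split this integral.  Lagrange's identity applied to the
    vectors (f_j)_j and (partial_k f_j)_j decomposes |f|^2 |grad f|^2 into the
    squares of the radial parts sum_j f_j partial_k f_j and the squares of the
    angular parts ([sqr_grad_norm]); where f does not vanish this is
    |grad f|^2 = |grad |f||^2 + |f|^2 |Phi'|^2.  Hence w |grad f| is the
    Euclidean length of a pair (U, V), with V the integrand of the phase term
    and U = w |grad |f||.  The integral of a length dominates the length of
    the integral, and a^p + b^p <= (a^2 + b^2)^(p/2) since p >= 2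
    ([integral_powRD_le]).

    Finally div (x |x|^s) = (n + s) |x|^s with s = gamma r, so the divergence
    theorem for the field x |x|^s |f|^r gives
    (n + s) int |x|^s |f|^r <= r int U ([weighted_divergence_le],
    [weighted_radial_le]).  The field is singular at the origin; it is
    replaced by fields of class C^1 whose radial weight increases to |x|^s, so
    that no local integrability of the weights has to be established.  The
    divergence theorem itself is only needed for compactly supported fields,
    where it reduces to Fubini and the fundamental theorem of calculus along
    lines ([integral_partial_eq0]). *)

(** * Powers of nonnegative functions *)

Section powR_calculus.
Variable R : realType.
Implicit Types (a t : R).

Lemma powR_continuous_gt0 a t : 0 < t ->
  {for t, continuous (fun s : R => s `^ a)}.
Proof.
move=> t0; apply: differentiable_continuous; apply/derivable1_diffP.
by apply: derivable_powR; rewrite in_itv/= t0.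
Qed.

(** The absolute value is there because [s `^ a] equals 1 for negative [s]:
    without it the function is discontinuous at 0. *)
Lemma continuous_norm_powR a : 0 < a -> continuous (fun s : R => `|s| `^ a).
Proof.
move=> a0 t; have [->|t0] := eqVneq t 0; last first.
  apply: (@continuous_comp _ _ _ (fun s : R => `|s|) (fun s => s `^ a)).
    exact: norm_continuous.
  by apply: powR_continuous_gt0; rewrite normr_gt0.
rewrite /continuous_at normr0 powR0 ?gt_eqF//.
apply/cvgrPdist_lt => e e0; near=> s.
rewrite sub0r normrN norm_powR// normr_id.
rewrite -[ltRHS](powRr1 (ltW e0)) -(mulVf (lt0r_neq0 a0)) powRrM.
rewrite gt0_ltr_powR// ?nnegrE ?powR_ge0//.
near: s; exists (e `^ a^-1) => [|s] /=; first exact: powR_gt0.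
by rewrite sub0r normrN.
Unshelve. all: by end_near. Qed.

(** At 0 the derivative exists and vanishes because the difference quotient is
    a bounded factor times |h|^(a-1), and [a > 1]. *)
Lemma is_derive_norm_powR a t : 1 < a -> 0 <= t ->
  is_derive t 1 (fun s : R => `|s| `^ a) (a * t `^ (a - 1)).
Proof.
move=> a1; rewrite le_eqVlt => /predU1P[<-|t0]; last first.
  apply: (@near_eq_is_derive R R R (fun s => s `^ a)).
    by near=> s; rewrite gtr0_norm//; near: s; exact: lt_nbhsr.
  exact: is_derive1_powR.
rewrite powR0 ?subr_eq0 ?gt_eqF// mulr0.
have H : (fun h : R => h^-1 *: (`|h *: (1 : R) + 0| `^ a - `|0 : R| `^ a))
    @ 0^' --> (0 : R).
  apply/cvgrPdist_lt => e e0; near=> h.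
  have h0 : h != 0 by near: h; exact: (@nbhs_dnbhs_neq R).
  rewrite sub0r normrN normr0 powR0 ?gt_eqF ?(lt_trans ltr01)// subr0 addr0.
  rewrite scaler1 normrZ norm_powR// normr_id normfV.
  rewrite -(mulr_powRB1 (normr_ge0 _)) ?(lt_trans ltr01)//.
  rewrite mulrA mulVf ?normr_eq0// mul1r.
  rewrite (_ : _ `^ _ = `|0 - `|h| `^ (a - 1)|);
    last by rewrite sub0r normrN [RHS]ger0_norm ?powR_ge0.
  near: h; apply: nbhs_dnbhs.
  have a10 : 0 < a - 1 by rewrite subr_gt0.
  have := @continuous_norm_powR (a - 1) a10 0.
  rewrite /continuous_at normr0 powR0 ?gt_eqF// => /cvgrPdist_lt/(_ e e0).
  exact.
apply: DeriveDef; first by apply/cvg_ex; exists 0.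
exact: (cvg_lim _ H).
Unshelve. all: by end_near. Qed.

Section directional.
Variables (V : normedModType R).
Implicit Types (f N : V -> R) (x v : V).

(** Directional derivatives are derivatives along a line, which reduces the
    chain rule to the one for functions of a real variable. *)
Lemma is_derive_lineP f x v d :
  is_derive x v f d <-> is_derive (0 : R) 1 (fun h : R => f (h *: v + x)) d.
Proof.
have E : (fun h : R => h^-1 *: (f (h *: v + x) - f x)) =
    (fun h : R =>
       h^-1 *: (f ((h *: (1 : R) + 0) *: v + x) - f ((0 : R) *: v + x))).
  by apply/funext => h; rewrite addr0 scaler1 scale0r add0r.
split => -[D dD]; split.
- by move: D; rewrite /derivable E.
- by move: dD; rewrite /derive E.
- by move: D; rewrite /derivable E.
- by move: dD; rewrite /derive E.
Qed.

Lemma is_derive_comp_real (phi : R -> R) f x v dphi df :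
  is_derive (f x) 1 phi dphi -> is_derive x v f df ->
  is_derive x v (phi \o f) (dphi * df).
Proof.
move=> hphi /is_derive_lineP hf; apply/is_derive_lineP.
apply: (is_derive1_comp (f := phi) (g := fun h => f (h *: v + x))).
by rewrite scale0r add0r.
Qed.

(** As [a > 1], the chain rule extends to the zeros of [N]; this is what makes
    |f|^r differentiable at the zeros of f, and the weights at the origin. *)
Lemma is_derive_powR N a x v d : (forall y, 0 <= N y) -> 1 < a ->
  is_derive x v N d ->
  is_derive x v (fun y => N y `^ a) (a * N x `^ (a - 1) * d).
Proof.
move=> N0 a1 Nd.
have -> : (fun y => N y `^ a) = (fun s => `|s| `^ a) \o N.
  by apply/funext => y /=; rewrite ger0_norm.
by apply: is_derive_comp_real => //; exact: is_derive_norm_powR.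
Qed.

End directional.

Lemma continuous_powR (T : topologicalType) (N : T -> R) a :
  (forall y, 0 <= N y) -> 0 < a -> continuous N ->
  continuous (fun y => N y `^ a).
Proof.
move=> N0 a0 cN.
have -> : (fun y => N y `^ a) = (fun s => `|s| `^ a) \o N.
  by apply/funext => y /=; rewrite ger0_norm.
by move=> y; apply: continuous_comp; [exact: cN|exact: continuous_norm_powR].
Qed.

End powR_calculus.

(** * Continuous functions on row vectors: measurability, integrability *)

Section borel_rV.
Variables (R : realType) (n : nat).
Notation rVm := 'rV[measurableTypeR R]_n.

Lemma measurable_box (A : 'I_n -> set R) : (forall i, measurable (A i)) ->
  measurable ([set x | forall i, A i (x ord0 i)] : set rVm).
Proof.
move=> mA; rewrite [X in measurable X](_ : _ = \bigcap_(i in [set: 'I_n])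
    ((fun x : rVm => x ord0 i) @^-1` A i)); last first.
  by apply/seteqP; split => [x Ax i _|x Ax i]; [exact: Ax|exact: (Ax i)].
apply: fin_bigcap_measurable => // i _; rewrite -[X in measurable X]setTI.
by apply: (@measurable_coord _ (measurableTypeR R) n i) => //; exact: mA.
Qed.

(** An open set is the union of the countably many boxes with rational
    endpoints that it contains. *)
Lemma open_measurable_rV (U : set 'rV[R]_n) : open U -> measurable (U : set rVm).
Proof.
move=> oU.
pose box (ab : 'rV[rat]_n * 'rV[rat]_n) : set rVm :=
  [set x | forall i,
     `]ratr (ab.1 ord0 i), ratr (ab.2 ord0 i)[%classic (x ord0 i)].
have -> : (U : set rVm) = \bigcup_k
    (if unpickle k is Some ab then
       if `[< box ab `<=` U >] then box ab else set0 else set0).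
  apply/seteqP; split => [x Ux|x [k _]]; last first.
    by case: (unpickle k) => // ab; case: asboolP => // + abx; exact.
  have /nbhs_ballP[e /= e0 xeU] := open_nbhs_nbhs (conj oU Ux).
  have ha i : exists q : rat, ratr q \in `]x ord0 i - e, x ord0 i[.
    by have [|q ?] := @rat_in_itvoo R (x ord0 i - e) (x ord0 i); [lra|exists q].
  have hb i : exists q : rat, ratr q \in `]x ord0 i, x ord0 i + e[.
    by have [|q ?] := @rat_in_itvoo R (x ord0 i) (x ord0 i + e); [lra|exists q].
  pose ab := (\row_i sval (cid (ha i)), \row_i sval (cid (hb i))).
  exists (pickle ab) => //; rewrite pickleK; case: asboolP => [_ i|[]].
    rewrite /= !mxE; case: cid => a /=; case: cid => b /=; rewrite !in_itv/=.
    by move=> /andP[-> _] /andP[_ ->].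
  move=> y yab; apply: xeU; split => // i j; rewrite ord1.
  have := yab j; rewrite /= !mxE; case: cid => a /=; case: cid => b /=.
  rewrite !in_itv/= /ball/= => /andP[? ?] /andP[? ?] /andP[? ?].
  by rewrite ltr_norml; apply/andP; split; lra.
apply: bigcupT_measurable => k; case: unpickle => [ab|]; last exact: measurable0.
case: asboolP => _; last exact: measurable0.
apply: (@measurable_box
  (fun i => `]ratr (ab.1 ord0 i), ratr (ab.2 ord0 i)[%classic)) => i.
exact: measurable_itv.
Qed.

Lemma continuous_measurable_rV (g : 'rV[R]_n -> R) :
  continuous g -> measurable_fun [set: rVm] (g : rVm -> R).
Proof.
move=> /continuousP cg; apply: (measurability _ (RGenOpens.measurableE R)).
move=> _ [_ [a [b ->] <-]]; rewrite setTI; apply: open_measurable_rV.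
exact/cg/interval_open.
Qed.

Lemma continuous_box_integrable (g : 'rV[R]_n -> R) M : continuous g ->
  (forall (x : 'rV[R]_n) i, M < `|x ord0 i| -> g x = 0) ->
  (lebesgue_rV R n).-integrable [set: rVm] (EFin \o (g : rVm -> R)).
Proof.
move=> cg g0.
pose B : set rVm := [set x | forall i, `[-M, M]%classic (x ord0 i)].
have mB : measurable B.
  apply: (@measurable_box (fun=> `[-M, M]%classic)) => i.
  exact: measurable_itv.
have -> : EFin \o (g : rVm -> R) = (EFin \o (g : rVm -> R)) \_ B.
  apply/funext => x; rewrite patchE; case: ifPn => //.
  rewrite notin_setE => Bx /=.
  move/existsNP : Bx => [i /=]; rewrite in_itv/= -ler_norml => /negP.
  by rewrite -ltNge => /g0 ->.
rewrite -integrable_mkcond//; apply: measurable_bounded_integrable => //.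
- have := @lebesgue_rV_box R n (fun=> `[-M, M]%classic) (fun=> measurable_itv _).
  rewrite -/B => muB; rewrite [ltLHS]muB.
  have lM : lebesgue_measure `[-M, M]%classic \is a fin_num.
    rewrite lebesgue_measure_itv/=; case: ifPn => // _.
  by rewrite -ge0_fin_numE; [exact: prode_fin_num|exact: prode_ge0].
- exact: measurable_funS (continuous_measurable_rV cg).
- have cB : compact
      ([set x | forall i, `[-M, M]%classic (x ord0 i)] : set 'rV[R]_n).
    apply: (@rV_compact R n (fun=> `[-M, M]%classic)) => i.
    exact: segment_compact.
  have [N [_ gN]] :=
    compact_bounded (continuous_compact (continuous_subspaceT cg) cB).
  exists N; split=> [|y Ny x Bx]; first exact: num_real.
  by apply: gN => //; exists x.
Qed.

End borel_rV.

(** * Integrals of partial derivatives *)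

Lemma integrable_comp_pushforward d1 d2 (X : measurableType d1)
    (Y : measurableType d2) (R : realType) (phi : X -> Y)
    (mphi : measurable_fun [set: X] phi) (mu : {measure set X -> \bar R})
    (g : Y -> \bar R) : (pushforward mu phi).-integrable [set: Y] g ->
  mu.-integrable [set: X] (g \o phi).
Proof.
move=> ig; have mg := measurable_int _ ig.
apply/integrableP; split; first exact: measurableT_comp mg mphi.
move/integrableP : ig => [_]; rewrite ge0_integral_pushforward//.
exact: measurableT_comp mg.
Qed.

Section total_derivative.
Variable R : realType.

Lemma integral_derive_eq0 (F f : R -> R) (M : R) :
  (forall t : R, is_derive t 1 F (f t)) -> continuous f ->
  (forall t : R, M < `|t| -> F t = 0) -> (forall t : R, M < `|t| -> f t = 0) ->
  (\int[@lebesgue_measure R]_t (f t)%:E = 0)%E.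
Proof.
move=> dF cf F0 f0; pose a : R := `|M| + 1.
have a0 : 0 < a by rewrite /a ltr_wpDl.
have Ma : M < a by rewrite (le_lt_trans (ler_norm M))// ltrDl.
transitivity (\int[@lebesgue_measure R]_(t in `[(- a)%R, a : R]) (f t)%:E)%E.
  rewrite [RHS]integral_mkcond; apply: eq_integral => t _.
  rewrite patchE; case: ifPn => //.
  rewrite notin_setE/= in_itv/= -ler_norml => /negP.
  by rewrite -ltNge => /(lt_trans Ma)/f0 ->.
have cF : continuous F.
  move=> t; apply: differentiable_continuous; apply/derivable1_diffP.
  exact: (@ex_derive _ _ _ _ _ _ _ (dF t)).
rewrite (@continuous_FTC2 _ f F).
- by rewrite !F0 ?subee// ?normrN gtr0_norm.
- by rewrite gtrN.
- exact: continuous_subspaceT.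
- split=> [t _||].
  + exact: (@ex_derive _ _ _ _ _ _ _ (dF t)).
  + exact/cvg_at_right_filter/cF.
  + exact/cvg_at_left_filter/cF.
- by move=> t _; rewrite derive1E (@derive_val _ _ _ _ _ _ _ (dF t)).
Qed.

Lemma cons_rV0 n t (x : 'rV[R]_n) : cons_rV (t, x) ord0 ord0 = t.
Proof. by rewrite /cons_rV mxE unlift_none. Qed.

Lemma cons_rVS n t (x : 'rV[R]_n) i :
  cons_rV (t, x) ord0 (lift ord0 i) = x ord0 i.
Proof. by rewrite /cons_rV mxE liftK. Qed.

Lemma continuous_cons_rVl n (x : 'rV[R]_n) :
  continuous (fun t : R => cons_rV (t, x)).
Proof.
move=> t A [P Pt PA].
have : nbhs t (P ord0 ord0) by have := Pt ord0 ord0; rewrite cons_rV0.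
apply: filterS => s Ps; apply: PA => i j; rewrite ord1.
have [k ->|->] := unliftP ord0 j; last by rewrite cons_rV0.
rewrite cons_rVS -(cons_rVS t); exact: nbhs_singleton.
Qed.

Lemma continuous_cons_rVr n (t : R) :
  continuous (fun x : 'rV[R]_n => cons_rV (t, x)).
Proof.
move=> x A [P Pt PA]; exists (fun i j => P i (lift ord0 j)) => [i j|y yP].
  by have := Pt i (lift ord0 j); rewrite [i]ord1 cons_rVS.
apply: PA => i j; rewrite [i]ord1.
have [k ->|->] := unliftP ord0 j; first by rewrite cons_rVS.
by have := nbhs_singleton (Pt ord0 ord0); rewrite !cons_rV0.
Qed.

Lemma is_derive_cons_rVl n (G : 'rV[R]_n.+1 -> R) t (x : 'rV[R]_n) d :
  is_derive (cons_rV (t, x)) (delta_mx ord0 ord0) G d ->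
  is_derive t 1 (fun s => G (cons_rV (s, x))) d.
Proof.
move=> /is_derive_lineP dG; apply/is_derive_lineP; move: dG.
congr (is_derive _ _ _ _); apply/funext => h; congr G.
apply/rowP => j; rewrite /cons_rV !mxE /=.
have [k ->|->] := unliftP ord0 j => /=; last by [].
by rewrite mulr0 add0r.
Qed.

Lemma is_derive_cons_rVr n (k : 'I_n) (G : 'rV[R]_n.+1 -> R) t (x : 'rV[R]_n) d :
  is_derive (cons_rV (t, x)) (delta_mx ord0 (lift ord0 k)) G d ->
  is_derive x (delta_mx ord0 k) (fun y => G (cons_rV (t, y))) d.
Proof.
move=> /is_derive_lineP dG; apply/is_derive_lineP; move: dG.
congr (is_derive _ _ _ _); apply/funext => h; congr G.
apply/rowP => j; rewrite /cons_rV !mxE /=.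
have [l ->|->] := unliftP ord0 j => /=.
  by rewrite !mxE (inj_eq lift_inj).
by rewrite mulr0 add0r.
Qed.

(** The measure on R^(n+1) is the image of the product of the measures on R
    and R^n.  By Fubini the variable of differentiation can be integrated first
    if it is the new coordinate, and last otherwise: then the inner integrals
    over R^n vanish by induction. *)
Lemma integral_partial_eq0 n (k : 'I_n) (G D : 'rV[R]_n -> R) (M : R) :
  (forall x, is_derive x (delta_mx ord0 k) G (D x)) -> continuous D ->
  (forall (x : 'rV[R]_n) i, M < `|x ord0 i| -> G x = 0) ->
  (forall (x : 'rV[R]_n) i, M < `|x ord0 i| -> D x = 0) ->
  (\int[lebesgue_rV R n]_x (D x)%:E = 0)%E.
Proof.
elim: n k G D => [[]//|n IH] k G D dG cD G0 D0.
have iD := continuous_box_integrable cD D0.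
have iDc := @integrable_comp_pushforward _ _ _ _ _ _
  (@measurable_cons_rV _ (measurableTypeR R) n)
  ((@lebesgue_measure R) \x (lebesgue_rV R n))%E _ iD.
have -> : (\int[lebesgue_rV R n.+1]_x (D x)%:E =
    \int[(@lebesgue_measure R) \x (lebesgue_rV R n)]_z
       ((EFin \o D) \o (@cons_rV _ (measurableTypeR R) n)) z)%E.
  exact: (integral_pushforward (measurable_cons_rV (n := n))
            (measurable_int _ iD) iDc measurableT).
case: (unliftP ord0 k) dG => [j|] -> dG.
  rewrite -(integral12_prod_meas1 iDc); apply: integral0_eq => t _.
  apply: (IH j (fun y => G (cons_rV (t, y))) (fun y => D (cons_rV (t, y)))).
  - by move=> x; exact: is_derive_cons_rVr.
  - move=> x; apply: continuous_comp; first exact: continuous_cons_rVr.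
    exact: cD.
  - by move=> x i Mx; apply: (G0 _ (lift ord0 i)); rewrite cons_rVS.
  - by move=> x i Mx; apply: (D0 _ (lift ord0 i)); rewrite cons_rVS.
rewrite -(integral21_prod_meas1 iDc); apply: integral0_eq => x _.
apply: (@integral_derive_eq0 (fun t => G (cons_rV (t, x))) _ M).
- by move=> t; exact: is_derive_cons_rVl.
- move=> t; apply: continuous_comp; first exact: continuous_cons_rVl.
  exact: cD.
- by move=> t Mt; apply: (G0 _ ord0); rewrite cons_rV0.
- by move=> t Mt; apply: (D0 _ ord0); rewrite cons_rV0.
Qed.

End total_derivative.

(** * Inequalities between integrals *)

Section integral_inequalities.
Context d (T : measurableType d) (R : realType).
Variable mu : {measure set T -> \bar R}.
Implicit Types F G U V W : T -> R.

Lemma ae_le_integral_real F G :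
  (forall x, 0 <= F x) -> (forall x, 0 <= G x) ->
  measurable_fun [set: T] F -> measurable_fun [set: T] G ->
  {ae mu, forall x, F x <= G x} ->
  (\int[mu]_x (F x)%:E <= \int[mu]_x (G x)%:E)%E.
Proof.
move=> F0 G0 mF mG FG; apply: ae_ge0_le_integral => //.
- by move=> x _; rewrite lee_fin.
- exact/measurable_EFinP.
- by move=> x _; rewrite lee_fin.
- exact/measurable_EFinP.
- by apply: filterS FG => x + _; rewrite lee_fin.
Qed.

(** Hoelder's inequality cleared of its roots; as an inequality between
    extended reals it covers infinite integrals too. *)
Lemma hoelder_poweR F G p : 1 < p ->
  (forall x, 0 <= F x) -> (forall x, 0 <= G x) ->
  measurable_fun [set: T] F -> measurable_fun [set: T] G ->
  ((\int[mu]_x (F x * G x)%:E) `^ p <=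
   \int[mu]_x (F x `^ p)%:E *
   (\int[mu]_x (G x `^ (p / (p - 1)))%:E) `^ (p - 1))%E.
Proof.
move=> p1 F0 G0 mF mG; set q := p / (p - 1).
have p0 : 0 < p by lra.
have q0 : 0 < q by rewrite divr_gt0 // subr_gt0.
have pq : p^-1 + q^-1 = 1 by rewrite /q; field; lra.
have LE (H : T -> R) (s : R) : 0 < s -> (forall x, 0 <= H x) ->
    (('N[mu]_s%:E[EFin \o H]) `^ s = \int[mu]_x (H x `^ s)%:E)%E.
  move=> s0 H0; rewrite poweR_Lnorm ?gt_eqF//; apply: eq_integral => x _.
  by rewrite gee0_abs ?lee_fin; [|exact: H0].
have := hoelder mu mF mG p0 q0 pq; rewrite Lnorm1.
rewrite (_ : (\int[mu]_x `|(EFin \o (F \* G)%R) x| =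
              \int[mu]_x (F x * G x)%:E)%E); last first.
  by apply: eq_integral => x _; rewrite gee0_abs // lee_fin mulr_ge0.
move=> /(gt0_ler_poweR (ltW p0)) => H.
apply: (le_trans (H _ _)).
- by rewrite in_itv/= leey andbT integral_ge0 => // x _; rewrite lee_fin mulr_ge0.
- by rewrite in_itv/= leey andbT; apply: mule_ge0; exact: Lnorm_ge0.
rewrite poweRM ?Lnorm_ge0// LE// -(LE G)// -poweRrM.
by rewrite (_ : q * (p - 1) = p) // /q; field; lra.
Qed.

(** Both [a] and [b] are at most c = sqrt (a^2 + b^2), so that
    a^p + b^p <= (a^2 + b^2) c^(p-2) = c^p. *)
Lemma powRD_le_sqrt (a b p : R) : 2 <= p -> 0 <= a -> 0 <= b ->
  a `^ p + b `^ p <= Num.sqrt (a ^+ 2 + b ^+ 2) `^ p.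
Proof.
move=> p2 a0 b0; set c := Num.sqrt _.
have c2 : c ^+ 2 = a ^+ 2 + b ^+ 2 by rewrite sqr_sqrtr// addr_ge0 ?sqr_ge0.
have c0 : 0 <= c by exact: sqrtr_ge0.
have p0 : p != 0 by lra.
have split2 y : 0 <= y -> y `^ p = y ^+ 2 * y `^ (p - 2).
  have pE : 2%:R + (p - 2) = p by ring.
  by move=> y0; rewrite -powR_mulrn// -powRD pE// (negbTE p0).
have H y : 0 <= y -> y <= c -> y `^ p <= y ^+ 2 * c `^ (p - 2).
  by move=> y0 yc; rewrite split2// ler_wpM2l ?sqr_ge0// ge0_ler_powR// subr_ge0.
rewrite [leRHS]split2//.
rewrite c2 mulrDl lerD// H//.
  by rewrite -(ler_sqr (y := c)) ?nnegrE// c2 lerDl sqr_ge0.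
by rewrite -(ler_sqr (y := c)) ?nnegrE// c2 lerDr sqr_ge0.
Qed.

(** Minkowski's integral inequality for the plane, followed by
    [powRD_le_sqrt].  By Cauchy-Schwarz, a U + b V <= W for every unit vector
    (a, b); integrating and taking (a, b) parallel to (int U, int V) gives
    sqrt ((int U)^2 + (int V)^2) <= int W. *)
Lemma integral_powRD_le U V W p : 2 <= p ->
  (forall x, 0 <= U x) -> (forall x, 0 <= V x) -> (forall x, 0 <= W x) ->
  measurable_fun [set: T] U -> measurable_fun [set: T] V ->
  measurable_fun [set: T] W ->
  {ae mu, forall x, U x ^+ 2 + V x ^+ 2 <= W x ^+ 2} ->
  ((\int[mu]_x (U x)%:E) `^ p + (\int[mu]_x (V x)%:E) `^ p <=
   (\int[mu]_x (W x)%:E) `^ p)%E.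
Proof.
move=> p2 U0 V0 W0 mU mV mW UVW.
have p0 : 0 < p by lra.
have comb a b : 0 <= a -> 0 <= b -> a ^+ 2 + b ^+ 2 = 1 ->
    (a%:E * \int[mu]_x (U x)%:E + b%:E * \int[mu]_x (V x)%:E <=
     \int[mu]_x (W x)%:E)%E.
  move=> a0 b0 ab.
  rewrite -!ge0_integralZl//; last 4 first.
  - exact/measurable_EFinP.
  - by move=> x _; rewrite lee_fin.
  - exact/measurable_EFinP.
  - by move=> x _; rewrite lee_fin.
  rewrite -ge0_integralD//; last 4 first.
  - by move=> x _; rewrite -EFinM lee_fin mulr_ge0.
  - by apply/measurable_EFinP; apply: measurable_funM.
  - by move=> x _; rewrite -EFinM lee_fin mulr_ge0.
  - by apply/measurable_EFinP; apply: measurable_funM.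
  apply: (@ae_le_integral_real (fun x => a * U x + b * V x)) => //.
  - by move=> x; rewrite addr_ge0 ?mulr_ge0.
  - by apply: measurable_funD; apply: measurable_funM.
  apply: filterS UVW => x UVWx.
  rewrite -(ler_sqr (y := W x)) ?nnegrE ?addr_ge0 ?mulr_ge0//.
  apply: le_trans UVWx; rewrite -subr_ge0.
  have -> : U x ^+ 2 + V x ^+ 2 - (a * U x + b * V x) ^+ 2 =
     (a ^+ 2 + b ^+ 2) * (U x ^+ 2 + V x ^+ 2) - (a * U x + b * V x) ^+ 2.
    by rewrite ab mul1r.
  have -> : (a ^+ 2 + b ^+ 2) * (U x ^+ 2 + V x ^+ 2) - (a * U x + b * V x) ^+ 2
     = (a * V x - b * U x) ^+ 2 by ring.
  exact: sqr_ge0.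
have int0 (H : T -> R) : (forall x, 0 <= H x) -> (0 <= \int[mu]_x (H x)%:E)%E.
  by move=> H0; apply: integral_ge0 => x _; rewrite lee_fin; exact: H0.
have [[X0 Y0] Z0] := (int0 U U0, int0 V V0, int0 W W0).
(* The coordinate directions show that an infinite int U or int V forces
   int W to be infinite. *)
have XZ := comb 1 0 ler01 (lexx _).
have YZ := comb 0 1 (lexx _) ler01.
move: XZ YZ; rewrite !mul0e !mul1e !adde0 !add0e expr0n/= expr1n addr0 add0r.
move=> /(_ erefl) XZ /(_ erefl) YZ.
move: X0 Y0 Z0 XZ YZ comb.
move: (\int[mu]_x (U x)%:E)%E (\int[mu]_x (V x)%:E)%E (\int[mu]_x (W x)%:E)%E.
move=> X Y [z| |]//; last by move=> *; rewrite poweRyr ?gt_eqF// leey.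
move: X Y => [x| |]// [y| |]//; rewrite !lee_fin => x0 y0 z0 xz yz comb.
apply: (le_trans (powRD_le_sqrt p2 x0 y0)).
rewrite ge0_ler_powR ?nnegrE ?sqrtr_ge0 ?(ltW p0)//.
set c := Num.sqrt _.
have c2 : c ^+ 2 = x ^+ 2 + y ^+ 2 by rewrite sqr_sqrtr// addr_ge0 ?sqr_ge0.
have [c0|c0] := eqVneq c 0; first by rewrite c0.
have cp : 0 < c by rewrite lt0r c0 sqrtr_ge0.
have := comb (x / c) (y / c).
rewrite !divr_ge0 ?(ltW cp)// => /(_ isT isT).
rewrite -!EFinM -EFinD lee_fin !expr_div_n -mulrDl -c2 divff ?expf_neq0//.
move=> /(_ erefl); rewrite mulrAC [y / c * y]mulrAC -!expr2 -mulrDl -c2.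
by rewrite expr2 mulfK.
Qed.

End integral_inequalities.

(** * The origin is negligible *)

Section origin.
Variables (R : realType) (n : nat).
Hypothesis n_gt0 : (0 < n)%N.

Let origin_box : [set (0 : 'rV[measurableTypeR R]_n)] =
  [set x : 'rV[measurableTypeR R]_n | forall i, [set 0 : R] (x ord0 i)].
Proof.
apply/seteqP; split => [x /= -> i|x x0]; first by rewrite mxE.
by apply/rowP => i; rewrite mxE; exact: x0.
Qed.

Lemma measurable_origin : measurable [set (0 : 'rV[measurableTypeR R]_n)].
Proof. by rewrite origin_box; exact: (@measurable_box R n (fun=> [set 0])). Qed.

Lemma lebesgue_rV_origin :
  lebesgue_rV R n [set (0 : 'rV[measurableTypeR R]_n)] = 0%E.
Proof.
rewrite origin_box (@lebesgue_rV_box R n (fun=> [set 0]))//.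
case: n n_gt0 => // k _; rewrite big_ord_recl.
by rewrite lebesgue_measure_set1 mul0e.
Qed.

Lemma ae_neq0 (P : 'rV[R]_n -> Prop) : (forall x : 'rV[R]_n, x != 0 -> P x) ->
  {ae lebesgue_rV R n, forall x, P x}.
Proof.
move=> P0; exists [set (0 : 'rV[measurableTypeR R]_n)]; split.
- exact: measurable_origin.
- exact: lebesgue_rV_origin.
- by move=> x /= nPx; apply/eqP; move: nPx; apply: contra_notT; exact: P0.
Qed.

End origin.

(** * Lagrange's identity *)

Section lagrange.
Variable R : realType.

(** The sum over all ordered pairs (j, l) of (a_l b_j - a_j b_l)^2 counts every
    pair j < l twice; expanding the squares gives twice the difference of the
    other two terms. *)
Lemma lagrange_identity m (a b : 'I_m -> R) :
  (\sum_j a j ^+ 2) * (\sum_j b j ^+ 2) =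
  (\sum_j a j * b j) ^+ 2 +
  \sum_(j < m) \sum_(l < m | (j < l)%N) (a l * b j - a j * b l) ^+ 2.
Proof.
pose S := \sum_j \sum_l (a l * b j - a j * b l) ^+ 2.
pose L := \sum_(j < m) \sum_(l < m | (j < l)%N) (a l * b j - a j * b l) ^+ 2.
have SL : S = L *+ 2.
  rewrite mulr2n {2}/L [X in _ + X](exchange_big_dep xpredT)//=.
  rewrite /S /L -big_split/=.
  apply: eq_bigr => j _.
  rewrite (bigID (fun l : 'I_m => (j < l)%N))/=; congr (_ + _).
  rewrite (bigID (fun l : 'I_m => (l < j)%N))/= [X in _ + X]big1 ?addr0.
    rewrite [in RHS]big_mkcond [in LHS]big_mkcond.
    apply: eq_bigr => l _; rewrite -leqNgt.
    case: ltngtP => //= _; ring.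
  move=> l; rewrite -!leqNgt -eqn_leq => /eqP/val_inj ->; ring.
have S2 : S =
    ((\sum_j a j ^+ 2) * (\sum_j b j ^+ 2) - (\sum_j a j * b j) ^+ 2) *+ 2.
  have e2 (u v : 'I_m -> R) :
      (\sum_j u j) * (\sum_j v j) = \sum_j \sum_l u l * v j.
    by rewrite mulr_sumr; apply: eq_bigr => j _; rewrite mulr_suml.
  rewrite mulrnBl mulr2n {2}[_ * _]mulrC expr2 !e2 -sumrMnl -big_split/= -sumrB.
  apply: eq_bigr => j _; rewrite -sumrMnl -big_split/= -sumrB.
  by apply: eq_bigr => l _; ring.
by rewrite SL in S2; rewrite -/L; lra.
Qed.

Lemma cauchy_schwarz_sum m (a b : 'I_m -> R) :
  `|\sum_j a j * b j| <=
  Num.sqrt (\sum_j a j ^+ 2) * Num.sqrt (\sum_j b j ^+ 2).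
Proof.
rewrite -sqrtrM; last by apply: sumr_ge0 => j _; exact: sqr_ge0.
rewrite -sqrtr_sqr ler_sqrt; last first.
  by rewrite mulr_ge0//; apply: sumr_ge0 => j _; exact: sqr_ge0.
rewrite lagrange_identity lerDl.
by apply: sumr_ge0 => j _; apply: sumr_ge0 => l _; exact: sqr_ge0.
Qed.

End lagrange.

(** * Calculus of the squared norm *)

Section continuity.
Variables (R : realType) (T : topologicalType).

Lemma continuous_sumr (I : Type) (s : seq I) (P : pred I) (F : I -> T -> R) :
  (forall i, continuous (F i)) ->
  continuous (fun x => \sum_(i <- s | P i) F i x).
Proof.
move=> cF; elim: s => [|i s IH].
  by under eq_fun do rewrite big_nil; exact: cst_continuous.
under eq_fun do rewrite big_cons; case: (P i) => // x.
by apply: (@continuousD _ _ _ (F i)); [exact: cF|exact: IH].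
Qed.

Lemma continuous_mulr (F G : T -> R) :
  continuous F -> continuous G -> continuous (fun x => F x * G x).
Proof.
by move=> cF cG x; apply: (@continuousM _ _ F G); [exact: cF|exact: cG].
Qed.

Lemma continuous_addr (F G : T -> R) :
  continuous F -> continuous G -> continuous (fun x => F x + G x).
Proof.
by move=> cF cG x; apply: (@continuousD _ _ _ F G); [exact: cF|exact: cG].
Qed.

Lemma continuous_sqrt (F : T -> R) :
  continuous F -> continuous (fun x => Num.sqrt (F x)).
Proof.
move=> cF x; apply: (@continuous_comp _ _ _ F); first exact: cF.
exact: sqrt_continuous.
Qed.

Lemma continuous_powR_gt0 (N : T -> R) (a : R) :
  (forall y, 0 < N y) -> continuous N -> continuous (fun y => N y `^ a).
Proof.
move=> N0 cN y; apply: (@continuous_comp _ _ _ N (fun s => s `^ a)).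
  exact: cN.
exact: powR_continuous_gt0.
Qed.

End continuity.

Lemma is_derive_mulr (R : realType) (V : normedModType R) (F G : V -> R)
    (x v : V) (dF dG : R) : is_derive x v F dF -> is_derive x v G dG ->
  is_derive x v (fun y => F y * G y) (dF * G x + F x * dG).
Proof.
move=> hF hG; have := is_deriveM hF hG.
by rewrite addrC /GRing.scale/= [G x * dF]mulrC.
Qed.

Section squared_norm.
Variables (R : realType) (n : nat).
Implicit Types x : 'rV[R]_n.

Definition sqnorm x : R := \sum_i x ord0 i ^+ 2.

Lemma sqnorm_ge0 x : 0 <= sqnorm x.
Proof. by apply: sumr_ge0 => i _; exact: sqr_ge0. Qed.

Lemma sqnorm_gt0 x : x != 0 -> 0 < sqnorm x.
Proof.
apply: contra_neqT; rewrite -leNgt => x0; apply/rowP => i; rewrite mxE.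
have /eqP : sqnorm x == 0 by rewrite eq_le x0 sqnorm_ge0.
rewrite /sqnorm => /psumr_eq0P => /(_ (fun i _ => sqr_ge0 _) i isT) /eqP.
by rewrite sqrf_eq0 => /eqP.
Qed.

Lemma enorm_powR x a : enorm x `^ a = sqnorm x `^ (a / 2).
Proof. by rewrite /enorm -powR12_sqrt ?sqnorm_ge0// -powRrM mulrC. Qed.

Lemma sqnorm0 : sqnorm 0 = 0.
Proof. by rewrite /sqnorm big1// => i _; rewrite mxE expr0n. Qed.

Lemma continuous_coord i : continuous (fun x => x ord0 i).
Proof. by move=> x; exact: coord_continuous. Qed.

Lemma continuous_sqnorm : continuous sqnorm.
Proof.
apply: continuous_sumr => i x; under eq_fun do rewrite expr2.
by apply: continuous_mulr; exact: continuous_coord.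
Qed.

Lemma is_derive_coord x (k i : 'I_n) :
  is_derive x (delta_mx ord0 k) (fun y => y ord0 i) (i == k)%:R.
Proof.
apply/is_derive_lineP.
have -> : (fun h : R => (h *: delta_mx ord0 k + x) ord0 i) =
    (fun h : R => h * (i == k)%:R + x ord0 i).
  by apply/funext => h; rewrite !mxE eqxx.
apply: is_derive_eq; rewrite ?scaler0 ?addr0 ?add0r.
by rewrite /GRing.scale/= mulr1.
Qed.

Lemma is_derive_sqnorm x (k : 'I_n) :
  is_derive x (delta_mx ord0 k) sqnorm (2 * x ord0 k).
Proof.
have -> : sqnorm = \sum_(i < n) (fun y : 'rV[R]_n => y ord0 i * y ord0 i).
  by apply/funext => y; rewrite fct_sumE; apply: eq_bigr => i _; rewrite expr2.
apply: is_derive_eq.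
  by apply: is_derive_sum => i; apply: is_derive_mulr; exact: is_derive_coord.
rewrite (bigD1 k)//= eqxx big1 ?addr0 => [|i /negbTE ->].
  by rewrite /=; ring.
by rewrite mul0r mulr0 addr0.
Qed.

Lemma measurable_enorm_powR (a : R) :
  measurable_fun [set: 'rV[measurableTypeR R]_n]
    (fun x : 'rV[R]_n => enorm x `^ a).
Proof.
under eq_fun do rewrite enorm_powR.
apply: (@measurableT_comp _ _ _ _ _ _ (fun t : R => t `^ (a / 2))) => //.
exact: (@continuous_measurable_rV R n sqnorm (@continuous_sqnorm)).
Qed.

End squared_norm.

(** * The divergence theorem for a radial weight *)

Section radial_weight.
Variables (R : realType) (n : nat).
Variables (g : 'rV[R]_n -> R) (dg : 'I_n -> 'rV[R]_n -> R) (M s : R).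
Hypothesis n_gt0 : (0 < n)%N.
Hypothesis g_ge0 : forall x, 0 <= g x.
Hypothesis g_der : forall k x, is_derive x (delta_mx ord0 k) g (dg k x).
Hypothesis g_cont : continuous g.
Hypothesis dg_cont : forall k, continuous (dg k).
Hypothesis g_supp : forall (x : 'rV[R]_n) i, M < `|x ord0 i| -> g x = 0.
Hypothesis dg_supp : forall k (x : 'rV[R]_n) i, M < `|x ord0 i| -> dg k x = 0.
Hypothesis ns_gt0 : 0 < n%:R + s.

(** With Q = |x|^2 the weight Q^a (Q + e)^(-q) equals |x|^s (Q / (Q + e))^q.
    Away from the origin it increases to |x|^s as [e] decreases to 0, and the
    choice of [q] makes the exponent [a] exceed 1, so that the weight is of
    class C^1 at the origin.  As (Q / (Q + e))^q is a nondecreasing function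
    of |x|, the Euler operator multiplies the weight by at least [s]
    (see [dweight_ge]). *)
Let q := `|s| / 2 + 2.
Let a := s / 2 + q.
Let q_gt0 : 0 < q. Proof. by rewrite /q; have := normr_ge0 s; lra. Qed.
Let a_gt1 : 1 < a.
Proof. by rewrite /a /q; have := ler_norm (- s); rewrite normrN; lra. Qed.

Let weight e (x : 'rV[R]_n) := sqnorm x `^ a * (sqnorm x + e) `^ (- q).

(** The k-th partial derivative of the weight is x_k times [dweight]. *)
Let dweight e (x : 'rV[R]_n) :=
  2 * (a * sqnorm x `^ (a - 1) * (sqnorm x + e) `^ (- q) +
       sqnorm x `^ a * (- q * (sqnorm x + e) `^ (- q - 1))).

Let sqnormD_gt0 e (x : 'rV[R]_n) : 0 < e -> 0 < sqnorm x + e.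
Proof. by move=> e0; rewrite ltr_wpDl// sqnorm_ge0. Qed.

Let weight_ge0 e x : 0 <= weight e x.
Proof. by rewrite mulr_ge0// powR_ge0. Qed.

Let is_derive_weight e (k : 'I_n) x : 0 < e ->
  is_derive x (delta_mx ord0 k) (weight e) (dweight e x * x ord0 k).
Proof.
move=> e0; have dQ := is_derive_sqnorm x k.
have dA := is_derive_powR (@sqnorm_ge0 R n) a_gt1 dQ.
have dQe : is_derive x (delta_mx ord0 k) (fun y => sqnorm y + e) (2 * x ord0 k).
  by rewrite -[X in is_derive _ _ _ X]addr0; exact: is_deriveD.
have dB := @is_derive_comp_real R _ _ (fun y => sqnorm y + e) _ _ _ _
  (@is_derive1_powR R (- q) _ (sqnormD_gt0 x e0)) dQe.
move: (is_derive_mulr dA dB); congr (is_derive _ _ _ _).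
by rewrite /dweight/=; ring.
Qed.

Let continuous_sqnormD e : continuous (fun x : 'rV[R]_n => sqnorm x + e).
Proof.
by apply: continuous_addr; [exact: continuous_sqnorm|exact: cst_continuous].
Qed.

Let continuous_weight e : 0 < e -> continuous (weight e).
Proof.
move=> e0; apply: continuous_mulr.
  apply: continuous_powR; [exact: sqnorm_ge0| |exact: continuous_sqnorm].
  exact: lt_trans a_gt1.
by apply: continuous_powR_gt0 => // y; exact: sqnormD_gt0.
Qed.

Let continuous_dweight e : 0 < e -> continuous (dweight e).
Proof.
move=> e0; apply: continuous_mulr; first exact: cst_continuous.
apply: continuous_addr; apply: continuous_mulr.
- apply: continuous_mulr; first exact: cst_continuous.
  apply: continuous_powR; [exact: sqnorm_ge0| |exact: continuous_sqnorm].
  by rewrite subr_gt0.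
- by apply: continuous_powR_gt0 => // y; exact: sqnormD_gt0.
- apply: continuous_powR; [exact: sqnorm_ge0| |exact: continuous_sqnorm].
  exact: lt_trans a_gt1.
- apply: continuous_mulr; first exact: cst_continuous.
  by apply: continuous_powR_gt0 => // y; exact: sqnormD_gt0.
Qed.

Let dweight_ge e x : 0 < e -> s * weight e x <= sqnorm x * dweight e x.
Proof.
move=> e0; have Q0 := sqnorm_ge0 x; have Qe := sqnormD_gt0 x e0.
rewrite /dweight /weight.
have E1 : sqnorm x * sqnorm x `^ (a - 1) = sqnorm x `^ a.
  by apply: mulr_powRB1 => //; exact: lt_trans a_gt1.
have E2 : (sqnorm x + e) `^ (- q) = (sqnorm x + e) * (sqnorm x + e) `^ (- q - 1).
  rewrite -{2}(powRr1 (ltW Qe)) -powRD; first by congr (_ `^ _); ring.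
  by rewrite (gt_eqF Qe) implybT.
have P0 := powR_ge0 (sqnorm x + e) (- q - 1).
have A0 := powR_ge0 (sqnorm x) a.
move: P0 A0 E1 E2 Q0.
set P := _ `^ (- q - 1); set A := _ `^ a; set B := _ `^ (- q).
set C := _ `^ (a - 1); set Q := sqnorm x => P0 A0 E1 E2 Q0.
rewrite -subr_ge0.
have -> : Q * (2 * (a * C * B + A * (- q * P))) - s * (A * B) =
    2 * a * (Q * C) * B - 2 * q * Q * A * P - s * A * B by ring.
(* 2a - s = 2q, and Q + e - Q = e. *)
rewrite E1 E2 (_ : _ - _ = 2 * q * e * (A * P)); first by rewrite !mulr_ge0// ltW.
by rewrite /a; field.
Qed.

Let weight_le e x : 0 < e -> x != 0 -> weight e x <= enorm x `^ s.
Proof.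
move=> e0 /sqnorm_gt0 Q0; rewrite enorm_powR /weight.
rewrite /a powRD; last by rewrite (gt_eqF Q0) implybT.
rewrite -mulrA -[leRHS]mulr1 ler_wpM2l ?powR_ge0//.
rewrite powRN -ler_pdivlMr ?invr_gt0 ?powR_gt0 ?addr_gt0// invrK mul1r.
rewrite ge0_ler_powR ?nnegrE ?(ltW q_gt0) ?(ltW Q0) ?lerDl ?(ltW e0)//.
by rewrite addr_ge0 ?ltW.
Qed.

Let flux e (k : 'I_n) (x : 'rV[R]_n) := x ord0 k * (weight e x * g x).

Let dflux e (k : 'I_n) (x : 'rV[R]_n) := 1 * (weight e x * g x) +
  x ord0 k * (dweight e x * x ord0 k * g x + weight e x * dg k x).

Let is_derive_flux e k x : 0 < e ->
  is_derive x (delta_mx ord0 k) (flux e k) (dflux e k x).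
Proof.
move=> e0; have dk := is_derive_coord x k k; rewrite eqxx in dk.
exact: is_derive_mulr dk (is_derive_mulr (is_derive_weight k x e0) (g_der k x)).
Qed.

Let continuous_wg e : 0 < e -> continuous (fun x => weight e x * g x).
Proof. by move=> e0; apply: continuous_mulr => //; exact: continuous_weight. Qed.

Let continuous_dflux e k : 0 < e -> continuous (dflux e k).
Proof.
move=> e0; apply: continuous_addr.
  apply: continuous_mulr; first exact: cst_continuous.
  exact: continuous_wg.
apply: continuous_mulr; first exact: continuous_coord.
apply: continuous_addr; last first.
  by apply: continuous_mulr => //; exact: continuous_weight.
apply: continuous_mulr => //.
by apply: continuous_mulr; [exact: continuous_dweight|exact: continuous_coord].
Qed.

Let integral_dflux e k : 0 < e ->
  (\int[lebesgue_rV R n]_x (dflux e k x)%:E = 0)%E.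
Proof.
move=> e0; apply: (@integral_partial_eq0 R n k (flux e k) _ M).
- by move=> x; exact: is_derive_flux.
- exact: continuous_dflux.
- by move=> x i /g_supp gx; rewrite /flux gx !mulr0.
- by move=> x i Mx; rewrite /dflux (g_supp Mx) (dg_supp _ Mx) !(mulr0, addr0).
Qed.

(** The divergence of x w g is (n + s) w g or more, plus the scalar product of
    w x with the gradient of [g], which Cauchy-Schwarz bounds from below. *)
Let divergence_ge e x : 0 < e ->
  (n%:R + s) * (weight e x * g x) - \sum_k dflux e k x <=
  enorm x `^ (s + 1) * Num.sqrt (\sum_k dg k x ^+ 2).
Proof.
move=> e0; set w := weight e x; set L := Num.sqrt _.
have -> : \sum_k dflux e k x =
    (n%:R * w + sqnorm x * dweight e x) * g x + w * \sum_k x ord0 k * dg k x.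
  rewrite /dflux big_split/= -/w sumr_const card_ord mulr_natl mul1r.
  rewrite mulrDl -addrA; congr (_ + _); first by rewrite mulrnAl.
  rewrite /sqnorm mulr_suml mulr_suml mulr_sumr -big_split/=.
  by apply: eq_bigr => k _; rewrite -/w; ring.
have sw : (s * w) * g x <= (sqnorm x * dweight e x) * g x.
  by rewrite ler_wpM2r// dweight_ge.
have CS : - \sum_k x ord0 k * dg k x <= enorm x * L.
  apply: le_trans (cauchy_schwarz_sum _ _).
  by rewrite -normrN ler_norm.
have L0 : 0 <= L by exact: sqrtr_ge0.
have wL : w * (enorm x * L) <= enorm x `^ (s + 1) * L.
  rewrite mulrA ler_wpM2r//; have [->|x0] := eqVneq x 0.
    by rewrite /enorm -/(sqnorm 0) sqnorm0 sqrtr0 mulr0 powR_ge0.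
  have ex : 0 < enorm x by rewrite sqrtr_gt0 sqnorm_gt0.
  rewrite powRD; last by rewrite (gt_eqF ex) implybT.
  by rewrite powRr1 ?(ltW ex)// ler_wpM2r ?(ltW ex)// weight_le.
have := ler_wpM2l (weight_ge0 e x) CS; rewrite -/w; lra.
Qed.

(** [divergence_ge] is integrated; the divergence has integral 0. *)
Let weighted_integral_le e : 0 < e ->
  ((n%:R + s)%:E * \int[lebesgue_rV R n]_x (weight e x * g x)%:E <=
   \int[lebesgue_rV R n]_x
     (enorm x `^ (s + 1) * Num.sqrt (\sum_k dg k x ^+ 2))%:E)%E.
Proof.
move=> e0.
have iw : (lebesgue_rV R n).-integrable setT
    (fun x : 'rV[measurableTypeR R]_n => (weight e x * g x)%:E).
  apply: (continuous_box_integrable (continuous_wg e0) (M := M)).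
  by move=> x i /g_supp ->; rewrite mulr0.
have id k : (lebesgue_rV R n).-integrable setT
    (fun x : 'rV[measurableTypeR R]_n => (dflux e k x)%:E).
  apply: (continuous_box_integrable (@continuous_dflux e k e0) (M := M)).
  by move=> x i Mx; rewrite /dflux (g_supp Mx) (dg_supp _ Mx) !(mulr0, addr0).
have iS : (lebesgue_rV R n).-integrable setT
    (fun x : 'rV[measurableTypeR R]_n => (\sum_k dflux e k x)%:E).
  apply: (@continuous_box_integrable _ _ _ M).
    by apply: continuous_sumr => k; exact: continuous_dflux.
  move=> x i Mx; rewrite big1// => k _.
  by rewrite /dflux (g_supp Mx) (dg_supp _ Mx) !(mulr0, addr0).
have S0 : (\int[lebesgue_rV R n]_x (\sum_k dflux e k x)%:E = 0)%E.
  under eq_integral do rewrite -sumEFin.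
  rewrite (integral_sum _ id)//; apply: big1 => k _; exact: integral_dflux.
set U : 'rV[measurableTypeR R]_n -> R := fun x =>
  enorm x `^ (s + 1) * Num.sqrt (\sum_k dg k x ^+ 2).
have U0 x : 0 <= U x by rewrite mulr_ge0 ?powR_ge0// sqrtr_ge0.
(* The right-hand side may be infinite; otherwise both sides of
   [divergence_ge] are integrable. *)
have [->|Uoo] := eqVneq (\int[lebesgue_rV R n]_x (U x)%:E)%E +oo%E.
  exact: leey.
have mU : measurable_fun setT U.
  apply: measurable_funM; first exact: measurable_enorm_powR.
  apply: (@continuous_measurable_rV _ _ (fun x => Num.sqrt (\sum_k dg k x ^+ 2))).
  apply: continuous_sqrt; apply: continuous_sumr => k.
  by under eq_fun do rewrite expr2; exact: continuous_mulr.
have iU : (lebesgue_rV R n).-integrable setT (EFin \o U).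
  apply/integrableP; split; first exact/measurable_EFinP.
  under eq_integral do rewrite gee0_abs ?lee_fin//.
  by rewrite ltey.
have iw' : (lebesgue_rV R n).-integrable setT
    (fun x : 'rV[measurableTypeR R]_n =>
       (n%:R + s)%:E * (weight e x * g x)%:E)%E.
  exact: integrableZl.
rewrite -integralZl// -[leLHS]sube0 -S0 -integralB//.
apply: le_integral => //; first exact: integrableB.
move=> x _; rewrite -EFinM -EFinB lee_fin; exact: divergence_ge.
Qed.

Let weight_nonincreasing e e' x : 0 < e -> e <= e' ->
  weight e' x <= weight e x.
Proof.
move=> e0 ee'; have e'0 := lt_le_trans e0 ee'.
have [Qe Qe'] := (sqnormD_gt0 x e0, sqnormD_gt0 x e'0).
rewrite ler_wpM2l ?powR_ge0// !powRN lef_pV2 ?posrE ?powR_gt0//.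
by rewrite ge0_ler_powR ?nnegrE ?lerD2l ?(ltW q_gt0) ?(ltW Qe) ?(ltW Qe').
Qed.

Let weight_cvg x : x != 0 ->
  (fun k => weight (k.+1%:R^-1) x) @ \oo --> enorm x `^ s.
Proof.
move=> /sqnorm_gt0 Q0.
have -> : enorm x `^ s = sqnorm x `^ a * (sqnorm x + 0) `^ (- q).
  rewrite enorm_powR addr0 -powRD; last by rewrite (gt_eqF Q0) implybT.
  by rewrite /a addrK.
apply: cvgM; first exact: cvg_cst.
have Qk : (fun k => sqnorm x + k.+1%:R^-1) @ \oo --> sqnorm x + 0.
  by apply: cvgD; [exact: cvg_cst|exact: cvg_harmonic].
have Q0' : 0 < sqnorm x + 0 by rewrite addr0.
exact: (cvg_comp _ (fun t : R => t `^ (- q)) Qk (powR_continuous_gt0 Q0')).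
Qed.

(** Monotone convergence as e = 1/(k+1) tends to 0.  The weights converge to
    |x|^s away from the origin only, hence the domain [D]. *)
Lemma weighted_divergence_le :
  ((n%:R + s)%:E * \int[lebesgue_rV R n]_x (enorm x `^ s * g x)%:E <=
   \int[lebesgue_rV R n]_x
     (enorm x `^ (s + 1) * Num.sqrt (\sum_k dg k x ^+ 2))%:E)%E.
Proof.
set RHS := (X in (_ <= X)%E).
have wg0 e x : 0 <= weight e x * g x by rewrite mulr_ge0.
have e0 k : 0 < (k.+1%:R^-1 : R) by rewrite invr_gt0.
have mwg k : measurable_fun [set: 'rV[measurableTypeR R]_n]
    (fun x : 'rV[R]_n => weight (k.+1%:R^-1) x * g x).
  by apply: continuous_measurable_rV; exact: continuous_wg.
pose D : set 'rV[measurableTypeR R]_n := setT `\` [set (0 : 'rV_n)].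
have mD : measurable D.
  by apply: measurableD => //; exact: measurable_origin.
rewrite (ge0_negligible_integral (@measurable_origin R n)) //; first last.
- exact: lebesgue_rV_origin.
- by move=> x _; rewrite lee_fin mulr_ge0 ?powR_ge0.
- apply/measurable_EFinP/measurable_funM; first exact: measurable_enorm_powR.
  exact: continuous_measurable_rV.
have -> : (\int[lebesgue_rV R n]_(x in D) (enorm x `^ s * g x)%:E =
    \int[lebesgue_rV R n]_(x in D)
      (limn (fun k => (weight (k.+1%:R^-1) x * g x)%:E)))%E.
  apply: eq_integral => x; rewrite inE => -[_ /eqP x0].
  apply/esym/cvg_lim => //; apply: cvg_EFin; first exact: nearW.
  by apply: cvgM; [exact: weight_cvg|exact: cvg_cst].
rewrite monotone_convergence//; first last.
- move=> x _ i j ij; rewrite lee_fin ler_wpM2r// weight_nonincreasing//.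
  by rewrite lef_pV2 ?posrE// ler_nat.
- by move=> k x _; rewrite lee_fin.
- by move=> k; apply/measurable_EFinP; exact: measurable_funTS.
rewrite -lee_pdivlMl//; apply: lime_le.
  apply: ereal_nondecreasing_is_cvgn => i j ij; apply: ge0_le_integral => //.
  - by move=> x _; rewrite lee_fin.
  - by apply/measurable_EFinP; exact: measurable_funTS.
  - by apply/measurable_EFinP; exact: measurable_funTS.
  - move=> x _; rewrite lee_fin ler_wpM2r// weight_nonincreasing//.
    by rewrite lef_pV2 ?posrE// ler_nat.
apply: nearW => k; rewrite lee_pdivlMl//.
apply: le_trans (weighted_integral_le (e0 k)).
rewrite lee_pmul2l//; apply: ge0_subset_integral => //.
- exact/measurable_EFinP.
- by move=> x _; rewrite lee_fin.
Qed.

End radial_weight.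

(** * Radial and angular parts of the gradient *)

Lemma coord_le_norm (R : realType) n (x : 'rV[R]_n) i : `|x ord0 i| <= `|x|.
Proof.
rewrite [leRHS]/Num.norm/= mx_normrE.
by apply/bigmax_geP; right => /=; exists (ord0, i).
Qed.

Section test_functions.
Variables (R : realType) (n m : nat) (f : 'rV[R]_n -> 'rV[R]_m).
Hypothesis hf : forall j : 'I_m, test_function (component f j).

(** The components have bounded supports; the sum of their bounds serves all
    of them at once. *)
Lemma test_function_box : exists M : R, forall (x : 'rV[R]_n) i,
  M < `|x ord0 i| -> f x = 0.
Proof.
have H (j : 'I_m) : exists M : R, 0 <= M /\ forall (x : 'rV[R]_n) i,
    M < `|x ord0 i| -> f x ord0 j = 0.
  have [_ /compact_bounded[M [_ HM]]] := hf j.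
  exists (`|M| + 1); split=> [|x i]; first by rewrite addr_ge0.
  apply: contraTeq => fx; rewrite -leNgt.
  apply: (le_trans (coord_le_norm x i)); apply: HM.
    by rewrite (le_lt_trans (ler_norm M))// ltrDl.
  exact: subset_closure.
have [B HB] := choice H.
exists (\sum_j B j) => x i Mx; apply/rowP => j; rewrite mxE.
apply: (proj2 (HB j) x i); apply: le_lt_trans Mx.
rewrite (bigD1 j)//= lerDl; apply: sumr_ge0 => l _; exact: (proj1 (HB l)).
Qed.

Lemma continuous_component j : continuous (component f j).
Proof. by have [/(_ [::])[]] := hf j. Qed.

Lemma continuous_partial k j : continuous (partial k (component f j)).
Proof. by have [/(_ [:: k])[]] := hf j. Qed.

Lemma is_derive_component k j x :
  is_derive x (delta_mx ord0 k) (component f j) (partial k (component f j) x).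
Proof. by have [/(_ [::])[_ +] _] := hf j => /(_ k x)/derivableP. Qed.

(** Half the k-th partial derivative of |f|^2, that is |f| times that of
    |f|. *)
Definition radial_part k (x : 'rV[R]_n) : R :=
  \sum_j component f j x * partial k (component f j) x.

(** The terms of |f|^4 |Phi'|^2 that come from the k-th partial derivatives. *)
Definition angular_part k (x : 'rV[R]_n) : R :=
  \sum_(j < m) \sum_(l < m | (j < l)%N)
    (component f l x * partial k (component f j) x -
     component f j x * partial k (component f l) x) ^+ 2.

Lemma angular_part_ge0 k x : 0 <= angular_part k x.
Proof. by do 2 (apply: sumr_ge0 => ? _); exact: sqr_ge0. Qed.

Lemma enorm_sqr x : enorm (f x) ^+ 2 = sqnorm (f x).
Proof. by rewrite sqr_sqrtr// sqnorm_ge0. Qed.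

Lemma sqr_grad_norm x : sqnorm (f x) * grad_norm f x ^+ 2 =
  \sum_k radial_part k x ^+ 2 + \sum_k angular_part k x.
Proof.
rewrite sqr_sqrtr; last first.
  by do 2 (apply: sumr_ge0 => ? _); exact: sqr_ge0.
rewrite mulr_sumr -big_split; apply: eq_bigr => k _ /=.
rewrite -lagrange_identity; congr (_ * _); apply: eq_bigr => j _.
by rewrite -normrX ger0_norm// sqr_ge0.
Qed.

Lemma phase_derivativeE x :
  phase_derivative f x = (sqnorm (f x))^-1 * Num.sqrt (\sum_k angular_part k x).
Proof.
have N0 : 0 <= (sqnorm (f x))^-1 by rewrite invr_ge0 sqnorm_ge0.
rewrite -[X in X * _](ger0_norm N0) -sqrtr_sqr -sqrtrM ?sqr_ge0//.
congr Num.sqrt; rewrite mulr_sumr; apply: eq_bigr => k _.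
rewrite mulr_sumr; apply: eq_bigr => j _.
rewrite mulr_sumr; apply: eq_bigr => l _.
by rewrite enorm_sqr; ring.
Qed.

Lemma continuous_sqnorm_f : continuous (fun x => sqnorm (f x)).
Proof.
apply: continuous_sumr => j; under eq_fun do rewrite expr2.
by apply: continuous_mulr; exact: continuous_component.
Qed.

Lemma is_derive_sqnorm_f k x :
  is_derive x (delta_mx ord0 k) (fun x => sqnorm (f x)) (2 * radial_part k x).
Proof.
have -> : (fun x => sqnorm (f x)) =
    \sum_(j < m) (fun y => component f j y * component f j y).
  by apply/funext => y; rewrite fct_sumE; apply: eq_bigr => i _; rewrite expr2.
apply: is_derive_eq.
  by apply: is_derive_sum => i; apply: is_derive_mulr; exact: is_derive_component.
by rewrite mulr_sumr; apply: eq_bigr => j _; ring.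
Qed.

Lemma continuous_radial_part k : continuous (radial_part k).
Proof.
apply: continuous_sumr => j.
apply: continuous_mulr; first exact: continuous_component.
exact: continuous_partial.
Qed.

Lemma continuous_angular_part k : continuous (angular_part k).
Proof.
apply: continuous_sumr => j; apply: continuous_sumr => l.
under eq_fun do rewrite -mulNr expr2.
have c : continuous (fun x => component f l x * partial k (component f j) x +
   - component f j x * partial k (component f l) x).
  apply: continuous_addr; apply: continuous_mulr.
  - exact: continuous_component.
  - exact: continuous_partial.
  - by move=> x; apply: continuousN; exact: continuous_component.
  - exact: continuous_partial.
exact: (continuous_mulr c c).
Qed.

Lemma continuous_grad_norm : continuous (grad_norm f).
Proof.
apply: continuous_sqrt; apply: continuous_sumr => k.
apply: continuous_sumr => j.
under eq_fun do rewrite -normrX ger0_norm ?sqr_ge0// expr2.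
by apply: continuous_mulr; exact: continuous_partial.
Qed.

Lemma measurable_enorm_f (a : R) :
  measurable_fun [set: 'rV[measurableTypeR R]_n]
    (fun x : 'rV[R]_n => enorm (f x) `^ a).
Proof.
under eq_fun do rewrite enorm_powR.
apply: (@measurableT_comp _ _ _ _ _ _ (fun t : R => t `^ (a / 2))) => //.
exact: (@continuous_measurable_rV R n _ continuous_sqnorm_f).
Qed.

(** The phase derivative is discontinuous at the zeros of f, so continuity is
    applied to its two factors separately. *)
Lemma measurable_phase_derivative :
  measurable_fun [set: 'rV[measurableTypeR R]_n] (phase_derivative f).
Proof.
have -> : phase_derivative f = (fun x =>
    sqnorm (f x) `^ (-1) * Num.sqrt (\sum_k angular_part k x)).
  by apply/funext => x; rewrite phase_derivativeE powR_inv1 ?sqnorm_ge0.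
apply: measurable_funM.
  apply: (@measurableT_comp _ _ _ _ _ _ (fun t : R => t `^ (-1))) => //.
  exact: (@continuous_measurable_rV R n _ continuous_sqnorm_f).
apply: (@continuous_measurable_rV R n
  (fun x => Num.sqrt (\sum_k angular_part k x))).
apply: continuous_sqrt; apply: continuous_sumr => k.
exact: continuous_angular_part.
Qed.

Definition radial_norm (x : 'rV[R]_n) : R :=
  Num.sqrt (\sum_k radial_part k x ^+ 2).

Lemma continuous_radial_norm : continuous radial_norm.
Proof.
apply: continuous_sqrt; apply: continuous_sumr => k.
by under eq_fun do rewrite expr2; apply: continuous_mulr;
  exact: continuous_radial_part.
Qed.

Section radial_inequality.
Variable r : R.
Hypothesis r_gt2 : 2 < r.

Let r_gt0 : 0 < r. Proof. exact: lt_trans r_gt2. Qed.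

Let enorm_powRE x : enorm (f x) `^ r = sqnorm (f x) * enorm (f x) `^ (r - 2).
Proof.
have rE : 2%:R + (r - 2) = r by ring.
rewrite -enorm_sqr -powR_mulrn ?sqrtr_ge0// -powRD rE//.
by rewrite gt_eqF.
Qed.

(** This is [sqr_grad_norm] multiplied by |f|^(2r-4): an equality where f does
    not vanish, while all terms are 0 at the zeros of f. *)
Lemma sqr_radial_phase_le x :
  (enorm (f x) `^ (r - 2) * radial_norm x) ^+ 2 +
  (phase_derivative f x * enorm (f x) `^ r) ^+ 2 <=
  (grad_norm f x * enorm (f x) `^ (r - 1)) ^+ 2.
Proof.
set c := enorm (f x) `^ (r - 2); set N := sqnorm (f x).
set SR := \sum_k radial_part k x ^+ 2; set SA := \sum_k angular_part k x.
have SA0 : 0 <= SA by apply: sumr_ge0 => k _; exact: angular_part_ge0.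
have SR0 : 0 <= SR by apply: sumr_ge0 => k _; exact: sqr_ge0.
have -> : (c * radial_norm x) ^+ 2 = c ^+ 2 * SR by rewrite exprMn sqr_sqrtr.
have -> : (grad_norm f x * enorm (f x) `^ (r - 1)) ^+ 2 = c ^+ 2 * (SR + SA).
  rewrite -sqr_grad_norm -enorm_sqr -(@mulr_powRB1 _ _ (r - 1)) ?sqrtr_ge0//.
    by rewrite (_ : r - 1 - 1 = r - 2) -/c; ring.
  by have := r_gt2; lra.
rewrite mulrDr lerD2l phase_derivativeE enorm_powRE -/c -/N -/SA.
rewrite (_ : _ ^+ 2 = c ^+ 2 * (N / N) ^+ 2 * Num.sqrt SA ^+ 2); last by ring.
rewrite sqr_sqrtr// ler_wpM2r// ler_piMr ?sqr_ge0//.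
by have [->|N0] := eqVneq N 0; rewrite ?mul0r ?expr0n ?divff// expr1n.
Qed.

(** [weighted_divergence_le] for g = |f|^r, whose partial derivatives are
    r |f|^(r-2) times the radial parts; [r > 2] makes them continuous. *)
Lemma weighted_radial_le s : (0 < n)%N -> 0 < n%:R + s ->
  (((n%:R + s) / r)%:E *
     \int[lebesgue_rV R n]_x (enorm x `^ s * enorm (f x) `^ r)%:E <=
   \int[lebesgue_rV R n]_x
     (enorm x `^ (s + 1) * (enorm (f x) `^ (r - 2) * radial_norm x))%:E)%E.
Proof.
move=> n0 ns0; have r2 : 1 < r / 2 by have := r_gt2; lra.
have N0 x : 0 <= sqnorm (f x) by exact: sqnorm_ge0.
pose g x := sqnorm (f x) `^ (r / 2).
pose c x := sqnorm (f x) `^ (r / 2 - 1).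
pose dg k x := r * (c x * radial_part k x).
have gE x : enorm (f x) `^ r = g x by rewrite enorm_powR.
have cE x : enorm (f x) `^ (r - 2) = c x.
  by rewrite enorm_powR; congr (_ `^ _); field.
have [M fM] := test_function_box.
have cg : continuous g.
  apply: continuous_powR => //; last exact: continuous_sqnorm_f.
  exact: lt_trans r2.
have cdg k : continuous (dg k).
  apply: continuous_mulr; first exact: cst_continuous.
  apply: continuous_mulr; last exact: continuous_radial_part.
  apply: continuous_powR => //; last exact: continuous_sqnorm_f.
  by rewrite subr_gt0.
have dgE k x : is_derive x (delta_mx ord0 k) g (dg k x).
  have := is_derive_powR N0 r2 (is_derive_sqnorm_f k x).
  by congr (is_derive _ _ _ _); rewrite /dg /c; field.
have g0 (x : 'rV[R]_n) i : M < `|x ord0 i| -> g x = 0.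
  move=> /fM fx; rewrite /g fx sqnorm0 powR0// gt_eqF//.
  exact: lt_trans r2.
have dg0 k (x : 'rV[R]_n) i : M < `|x ord0 i| -> dg k x = 0.
  move=> /fM fx; rewrite /dg /c fx sqnorm0 powR0 ?mul0r ?mulr0//.
  by rewrite gt_eqF// subr_gt0.
have := @weighted_divergence_le R n g dg M s n0
  (fun x => powR_ge0 _ _) dgE cg cdg g0 dg0 ns0.
pose U (x : 'rV[measurableTypeR R]_n) : R :=
  enorm x `^ (s + 1) * (c x * radial_norm x).
have U0 x : 0 <= U x by rewrite !mulr_ge0 ?powR_ge0 ?sqrtr_ge0.
have mU : measurable_fun [set: 'rV[measurableTypeR R]_n] U.
  apply: measurable_funM; first exact: measurable_enorm_powR.
  apply: (@continuous_measurable_rV R n (fun x => c x * radial_norm x)).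
  apply: continuous_mulr; last exact: continuous_radial_norm.
  apply: continuous_powR => //; last exact: continuous_sqnorm_f.
  by rewrite subr_gt0.
have dgU x : enorm x `^ (s + 1) * Num.sqrt (\sum_k dg k x ^+ 2) = r * U x.
  have rc0 : 0 <= r * c x by rewrite mulr_ge0 ?powR_ge0 ?ltW.
  rewrite /U mulrCA; congr (_ * _); rewrite mulrA -[X in X * _](ger0_norm rc0).
  rewrite -sqrtr_sqr -sqrtrM ?sqr_ge0// mulr_sumr.
  by congr Num.sqrt; apply: eq_bigr => k _; rewrite /dg; ring.
under [X in (_ <= X)%E]eq_integral do rewrite dgU EFinM.
rewrite ge0_integralZl//; last 3 first.
- exact/measurable_EFinP.
- by move=> x _; rewrite lee_fin.
- by rewrite lee_fin ltW.
rewrite -lee_pdivrMl// muleA -EFinM [r^-1 * _]mulrC.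
under [X in (_ * X <= _)%E -> _]eq_integral do rewrite -gE.
by under [X in (_ <= X)%E -> _]eq_integral do rewrite /U -cE.
Qed.

End radial_inequality.

End test_functions.

Theorem theorem1p8 (R : realType) (n m : nat) (f : 'rV[R]_n -> 'rV[R]_m)
    (p r alpha beta gamma : R)
    (hn : (2 <= n)%N) (hm : (1 <= m)%N)
    (hf : forall j : 'I_m, test_function (component f j))
    (hp : 2 < p) (hr : p < r)
    (halpha : 0 < 1 / p + alpha / n%:R)
    (hbeta : 0 < (p - 1) / (p * (r - 1)) + beta / n%:R)
    (hgamma : 0 < 1 / r + gamma / n%:R)
    (hbalance : gamma = 1 / r * (alpha - 1) + (p - 1) / (p * r) * beta) :
  ((\int[lebesgue_rV R n]_x
      (enorm x `^ (alpha * p) * grad_norm f x `^ p)%:E) *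
   (\int[lebesgue_rV R n]_x
      (enorm x `^ beta * enorm (f x) `^ (p * (r - 1) / (p - 1)))%:E)
     `^ (p - 1) >=
   (((n%:R + gamma * r) / r) `^ p)%:E *
   (\int[lebesgue_rV R n]_x
      (enorm x `^ (gamma * r) * enorm (f x) `^ r)%:E) `^ p +
   (\int[lebesgue_rV R n]_x
      (enorm x `^ (r * gamma + 1) * phase_derivative f x *
       enorm (f x) `^ r)%:E) `^ p)%E.
Proof.
have n0 : (0 < n)%N by exact: leq_trans hn.
have nR0 : 0 < n%:R :> R by rewrite ltr0n.
have r0 : 0 < r by lra.
have p0 : 0 < p by lra.
set s := gamma * r.
have ns0 : 0 < n%:R + s.
  have -> : n%:R + s = (1 / r + gamma / n%:R) * (r * n%:R).
    by rewrite /s; field; rewrite !gt_eqF.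
  by rewrite !mulr_gt0.
(* With this b, the balance condition reads s + 1 = alpha + b. *)
pose b := beta * (p - 1) / p.
have sE : s + 1 = alpha + b.
  by rewrite /s /b hbalance; field; rewrite !gt_eqF.
pose mT := [set: 'rV[measurableTypeR R]_n].
pose U (x : 'rV[measurableTypeR R]_n) : R :=
  enorm x `^ (s + 1) * (enorm (f x) `^ (r - 2) * radial_norm f x).
pose V (x : 'rV[measurableTypeR R]_n) : R :=
  enorm x `^ (r * gamma + 1) * phase_derivative f x * enorm (f x) `^ r.
pose F (x : 'rV[measurableTypeR R]_n) : R := enorm x `^ alpha * grad_norm f x.
pose G (x : 'rV[measurableTypeR R]_n) : R :=
  enorm x `^ b * enorm (f x) `^ (r - 1).
have U0 x : 0 <= U x by rewrite !mulr_ge0 ?powR_ge0 ?sqrtr_ge0.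
have V0 x : 0 <= V x by rewrite !mulr_ge0 ?powR_ge0 ?sqrtr_ge0.
have F0 x : 0 <= F x by rewrite mulr_ge0 ?powR_ge0 ?sqrtr_ge0.
have G0 x : 0 <= G x by rewrite mulr_ge0 ?powR_ge0.
have mU : measurable_fun mT U.
  apply: measurable_funM; first exact: measurable_enorm_powR.
  apply: measurable_funM; first exact: measurable_enorm_f.
  exact: (@continuous_measurable_rV R n _ (continuous_radial_norm hf)).
have mV : measurable_fun mT V.
  apply: measurable_funM; last exact: measurable_enorm_f.
  apply: measurable_funM; first exact: measurable_enorm_powR.
  exact: measurable_phase_derivative.
have mF : measurable_fun mT F.
  apply: measurable_funM; first exact: measurable_enorm_powR.
  exact: (@continuous_measurable_rV R n _ (continuous_grad_norm hf)).
have mG : measurable_fun mT G.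
  apply: measurable_funM; first exact: measurable_enorm_powR.
  exact: measurable_enorm_f.
have mFG : measurable_fun mT (fun x => F x * G x) by exact: measurable_funM.
(* The origin has to be excluded: 0^(alpha + b) = 1 when alpha + b = 0, while
   0^alpha 0^b may be 0. *)
have UVFG : {ae lebesgue_rV R n, forall x,
    U x ^+ 2 + V x ^+ 2 <= (F x * G x) ^+ 2}.
  apply: (ae_neq0 n0) => x x0.
  have ex : enorm x != 0 by rewrite gt_eqF// sqrtr_gt0 sqnorm_gt0.
  rewrite /U /V /F /G mulrACA -powRD ?ex ?implybT// -sE.
  rewrite (_ : r * gamma + 1 = s + 1); last by rewrite /s mulrC.
  rewrite -[X in _ + X ^+ 2]mulrA !(exprMn _ (enorm x `^ (s + 1))) -mulrDr.
  by rewrite ler_wpM2l ?sqr_ge0// sqr_radial_phase_le// (lt_trans hp).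
have UVFG_int := @integral_powRD_le _ _ R (lebesgue_rV R n) U V
  (fun x => F x * G x) p (ltW hp) U0 V0 (fun x => mulr_ge0 (F0 x) (G0 x))
  mU mV mFG UVFG.
have p1 : 1 < p by lra.
have FE x : F x `^ p = enorm x `^ (alpha * p) * grad_norm f x `^ p.
  by rewrite /F powRM ?powR_ge0 ?sqrtr_ge0// -powRrM.
have GE x : G x `^ (p / (p - 1)) =
    enorm x `^ beta * enorm (f x) `^ (p * (r - 1) / (p - 1)).
  rewrite /G powRM ?powR_ge0// -!powRrM; congr (_ `^ _ * _ `^ _).
    by rewrite /b; field; lra.
  by field; lra.
have := @hoelder_poweR _ _ R (lebesgue_rV R n) F G p p1 F0 G0 mF mG.
under [X in (_ <= X * _)%E]eq_integral do rewrite FE.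
under [X in (_ <= _ * X `^ _)%E]eq_integral do rewrite GE.
apply: le_trans; apply: le_trans UVFG_int; rewrite leeD2r//.
have I0 : (0 <= \int[lebesgue_rV R n]_x
    (enorm x `^ s * enorm (f x) `^ r)%:E)%E.
  by apply: integral_ge0 => x _; rewrite lee_fin mulr_ge0// powR_ge0.
have nsr0 : 0 <= (n%:R + s) / r by rewrite divr_ge0 ?ltW.
rewrite -poweR_EFin -poweRM ?lee_fin//.
apply: gt0_ler_poweR (weighted_radial_le hf (lt_trans hp hr) n0 ns0).
- exact: ltW.
- by rewrite in_itv/= leey andbT mule_ge0.
- rewrite in_itv/= leey andbT.
  by apply: integral_ge0 => x _; rewrite lee_fin; exact: U0.
Qed.
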